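(* Let $\mu$ be a positive Borel measure on $\mathbb{R}$, absolutely continuous with respect to Lebesgue measure, with finite moments of all orders, supported on a set $E$ with infinitely many points whose convex hull is $[a,b]$, and let $c<a$, $N>0$. With the notation of the context, for every $n\ge1$, $$c<y_{n,1}^{c,N}<y_{n,1}^{c}<x_{n-1,1}^{c,[1]}<y_{n,2}^{c,N}<y_{n,2}^{c}<\cdots<x_{n-1,n-1}^{c,[1]}<y_{n,n}^{c,N}<y_{n,n}^{c}.$$ Moreover each $y_{n,k}^{c,N}$ is a decreasing function of $N$, and for each $k=1,\ldots,n-1$, $$\lim_{N\to\infty}y_{n,1}^{c,N}=c,\qquad \lim_{N\to\infty}y_{n,k+1}^{c,N}=x_{n-1,k}^{c,[1]},$$ $$\lim_{N\to\infty}N\,[y_{n,1}^{c,N}-c]=\frac{-Q_n^c(c)}{B_n^c\,P_{n-1}^{c,[1]}(c)},\qquad \lim_{N\to\infty}N\,[y_{n,k+1}^{c,N}-x_{n-1,k}^{c,[1]}]=\frac{-Q_n^c(x_{n-1,k}^{c,[1]})}{B_n^c\,(x_{n-1,k}^{c,[1]}-c)\,[P_{n-1}^{c,[1]}]'(x_{n-1,k}^{c,[1]})}.$$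
   Context: $\{P_n\}$ is the monic orthogonal polynomial sequence (MOPS) for $\mu$, $\|f\|_\mu^2=\int f^2d\mu$. $\{Q_n^c\}$ is the MOPS for $\langle f,g\rangle_\nu=\int f g\frac{1}{x-c}d\mu$. $\{P_n^{c,[1]}\}$ is the MOPS for $(x-c)d\mu(x)$, i.e. $P_n^{c,[1]}(x)=\frac{1}{x-c}\big(P_{n+1}(x)-\frac{P_{n+1}(c)}{P_n(c)}P_n(x)\big)$. $\{Q_n^{c,N}\}$ is the MOPS for $\langle f,g\rangle_{\nu_N}=\int fg\frac{1}{x-c}d\mu+Nf(c)g(c)$. $B_n^c=\frac{-Q_n^c(c)P_{n-1}(c)}{\|P_{n-1}\|_\mu^2}$. The zeros of $Q_n^c$, $Q_n^{c,N}$, $P_{n-1}^{c,[1]}$ are denoted $y_{n,s}^c$, $y_{n,s}^{c,N}$ ($s=1,\dots,n$), $x_{n-1,s}^{c,[1]}$ ($s=1,\dots,n-1$), each arranged in increasing order. *)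

(* Defs.v *)
From HB Require Import structures.
From mathcomp Require Import all_boot all_order all_algebra.
From mathcomp Require Import all_classical all_reals all_analysis.
Set Implicit Arguments. Unset Strict Implicit. Unset Printing Implicit Defensive.
Import Order.TTheory GRing.Theory Num.Theory.
Import numFieldNormedType.Exports.
Local Open Scope classical_set_scope.
Local Open Scope ring_scope.

Section Defs.
Context {R : realType}.
Notation M := (measurableTypeR R).

Definition msupport (mu : {measure set M -> \bar R}) : set R :=
  [set x | forall e : R, 0 < e -> (0 < mu (ball x e))%E].

Definition wip (mu : {measure set M -> \bar R}) (w : R -> R)
    (f g : {poly R}) : R :=
  fine (\int[mu]_x (f.[x] * g.[x] * w x)%:E)%E.

Definition mu_ip mu := wip mu (fun _ => 1).
Definition nu_ip mu (c : R) := wip mu (fun x => (x - c)^-1).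
Definition nuN_ip mu (c N : R) (f g : {poly R}) : R :=
  nu_ip mu c f g + N * f.[c] * g.[c].
Definition mu1_ip mu (c : R) := wip mu (fun x => x - c).

Definition is_MOPS (ip : {poly R} -> {poly R} -> R) (P : nat -> {poly R}) :=
  forall n, P n \is monic /\ size (P n) = n.+1 /\ ip (P n) (P n) != 0 /\
    forall m, m != n -> ip (P n) (P m) = 0.

Definition is_zero_list (p : {poly R}) (s : seq R) :=
  sorted <%R s /\ forall x, root p x <-> x \in s.

Definition zeros (p : {poly R}) : seq R :=
  match pselect (exists s, is_zero_list p s) with
  | left h => projT1 (cid h)
  | right _ => [::]
  end.

End Defs.

(* Main.v *)
(* Put L p = \int p(x) / (x - c) dmu, a linear functional that is positive on
   polynomials nonnegative on [a, b]; the inner products of the statement are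
   L (f g), L ((x - c) f g), L ((x - c)^2 f g) and L (f g) + N f(c) g(c).
   Let G = (x - c) P1_(n-1).  It reproduces values at c: L (G f) = kappa f(c)
   with kappa = L G for deg f < n.  This gives kappa P_(n-1)(c) = |P_(n-1)|^2,
   so B = - Q_n(c) / kappa, and (1 + N B) QN_n = Q_n + N B G by orthogonality.
   If Q_n = (x - y) r with y a zero, then G - (G(y) / r(y)) r is divisible by
   x - y, hence G(y) L (r^2) = kappa r(c) r(y); so G has the sign of Q_n'(y) at
   every zero y of Q_n and the zeros of G and Q_n interlace.  The rest concerns
   the pencil Q + t G of two polynomials with interlacing zeros z_k < y_k: it has
   exactly one zero in each ]z_k, y_k[, moving left as t grows because Q + t' G
   is, up to a scalar, in the pencil of Q + t G and G; and a zero w of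
   Q + N B G satisfies N (w - z_k) = - Q(w) / (B g(w)) with G = (x - z_k) g. *)

Require Import Defs.
From HB Require Import structures.
From mathcomp Require Import all_boot all_order all_algebra.
From mathcomp Require Import polyrcf ring.
From mathcomp Require Import all_classical all_reals all_analysis.
From mathcomp Require Import measurable_realfun.
Import Order.TTheory GRing.Theory Num.Theory.
Import numFieldNormedType.Exports.
Local Open Scope classical_set_scope.
Local Open Scope ring_scope.

(** * Sign changes, interlacing lists and pencils of polynomials *)

Section RootLists.
Set Implicit Arguments. Unset Strict Implicit.
Context {R : realType}.
Implicit Types (p f g : {poly R}) (s : seq R) (x : R).

Lemma zerosE p s : is_zero_list p s -> zeros p = s.
Proof.
move=> [ss sp]; rewrite /zeros.
case: pselect => [h|]; last by case; exists s.
case: cid => t /= [st tp].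
apply: lt_sorted_eq => // x.
by apply/idP/idP => [/tp/sp|/sp/tp].
Qed.

Lemma prod_XsubC_gt0 s x : all (< x) s -> 0 < (\prod_(y <- s) ('X - y%:P)).[x].
Proof.
elim: s => [|y s IH] /=; first by rewrite big_nil hornerE.
by case/andP=> yx /IH h; rewrite big_cons hornerM mulr_gt0// !hornerE subr_gt0.
Qed.

Lemma prod_XsubC_sign s x :
  all (> x) s -> 0 < (-1) ^+ size s * (\prod_(y <- s) ('X - y%:P)).[x].
Proof.
elim: s => [|y s IH] /=; first by rewrite big_nil !hornerE.
case/andP=> yx /IH h; rewrite big_cons hornerM exprS mulrACA mulr_gt0//.
by rewrite !hornerE mulN1r opprB subr_gt0.
Qed.

Lemma prod_XsubC_sign_nth s x k : (k <= size s)%N ->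
  (forall j, (j < k)%N -> s`_j < x) ->
  (forall j, (k <= j < size s)%N -> x < s`_j) ->
  0 < (-1) ^+ (size s - k) * (\prod_(y <- s) ('X - y%:P)).[x].
Proof.
move=> ks hl hr.
rewrite -[in X in _ * X](cat_take_drop k s) big_cat hornerM mulrCA.
rewrite mulr_gt0//.
  apply/prod_XsubC_gt0/(all_nthP 0) => j.
  by rewrite size_takel// => jk; rewrite nth_take//; exact: hl.
rewrite -size_drop; apply/prod_XsubC_sign/(all_nthP 0) => j.
rewrite size_drop ltn_subRL nth_drop => jk; apply: hr.
by rewrite leq_addr.
Qed.

Lemma zero_list_prod s : sorted <%R s -> is_zero_list (\prod_(y <- s) ('X - y%:P)) s.
Proof. by move=> ss; split=> // x; rewrite root_prod_XsubC. Qed.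

(** The intermediate value theorem puts a zero in each of [m] disjoint open intervals; a polynomial
    of degree [m] has no others, so they give its full factorization. *)
Lemma zero_list_of_sign_changes f m (l u : nat -> R) : size f = m.+1 ->
  (forall k, (k < m)%N -> l k < u k) ->
  (forall k, (k.+1 < m)%N -> u k <= l k.+1) ->
  (forall k, (k < m)%N -> f.[l k] * f.[u k] < 0) ->
  exists w, [/\ size w = m, sorted <%R w,
    f = lead_coef f *: \prod_(y <- w) ('X - y%:P) &
    forall k, (k < m)%N -> l k < w`_k < u k].
Proof.
move=> sf lu ul fs.
have /choice[v hv] : forall k, exists x, (k < m)%N -> l k < x < u k /\ root f x.
  move=> k; case: (ltnP k m) => km; last by exists 0.
  have [x] := @poly_ivtoo _ f _ _ (ltW (lu _ km)) (fs _ km).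
  by rewrite in_itv => ? ?; exists x.
have wv k : (k < m)%N -> (mkseq v m)`_k = v k by move=> km; rewrite nth_mkseq.
have sw : sorted <%R (mkseq v m).
  apply/(sortedP 0) => k; rewrite size_mkseq => km; rewrite !wv//; last exact: ltnW.
  have [/andP[_ h1] _] := hv _ (ltnW km); have [/andP[h2 _] _] := hv _ km.
  by rewrite (lt_trans h1)// (le_lt_trans _ h2)// ul.
exists (mkseq v m); split => //.
- exact: size_mkseq.
- apply: all_roots_prod_XsubC; first by rewrite size_mkseq.
    apply/(all_nthP 0) => k; rewrite size_mkseq => km; rewrite wv//.
    by have [] := hv _ km.
  by rewrite uniq_rootsE lt_sorted_uniq.
- by move=> k km; rewrite wv//; have [] := hv _ km.
Qed.

(** The two lists have equal length and [zs] leads. In use [zs] is [c :: xs], so [c] counts as the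
    leftmost zero. *)
Definition interlaced (zs ys : seq R) :=
  [/\ size zs = size ys, (forall k, (k < size ys)%N -> zs`_k < ys`_k) &
   (forall k, (k.+1 < size ys)%N -> ys`_k < zs`_k.+1)].

Lemma interlaced_sorted zs ys : interlaced zs ys -> sorted <%R zs /\ sorted <%R ys.
Proof.
move=> [sz zy yz]; split; apply/(sortedP 0) => k ks.
  rewrite sz in ks; exact: lt_trans (zy k (ltnW ks)) (yz k ks).
exact: lt_trans (yz k ks) (zy k.+1 ks).
Qed.

Lemma lt_nth_mono s i j : sorted <%R s -> (i < j < size s)%N -> s`_i < s`_j.
Proof.
move=> ss /andP[ij js].
by rewrite (lt_sorted_ltn_nth 0 ss) ?inE// (ltn_trans ij).
Qed.

Lemma le_nth_mono s i j : sorted <%R s -> (i <= j < size s)%N -> s`_i <= s`_j.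
Proof.
move=> ss /andP[ij js].
by rewrite (lt_sorted_leq_nth 0 ss) ?inE// (leq_ltn_trans ij).
Qed.

Lemma signs_neq (m : nat) (u v : R) :
  0 < (-1) ^+ m.+1 * u -> 0 < (-1) ^+ m * v -> u * v < 0.
Proof.
move=> hu hv; have := mulr_gt0 hu hv.
by rewrite exprS mulrACA mulN1r mulNr -expr2 sqrr_sign mulN1r oppr_gt0.
Qed.

Lemma interlaced_sign_left zs ys k : interlaced zs ys -> (k < size ys)%N ->
  0 < (-1) ^+ (size ys - k) * (\prod_(y <- ys) ('X - y%:P)).[zs`_k].
Proof.
move=> zy ks; have [sz sy] := interlaced_sorted zy.
have [szy hzy hyz] := zy.
apply: prod_XsubC_sign_nth => [|j jk|j /andP[kj js]]; first exact: ltnW.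
  rewrite (lt_le_trans (hyz j _))//; first exact: leq_trans ks.
  by apply: le_nth_mono; rewrite ?szy ?jk.
by rewrite (lt_le_trans (hzy _ ks))// le_nth_mono ?kj.
Qed.

Lemma interlaced_sign_right zs ys k : interlaced zs ys -> (k < size ys)%N ->
  0 < (-1) ^+ (size ys - k.+1) * (\prod_(z <- zs) ('X - z%:P)).[ys`_k].
Proof.
move=> zy ks; have [sz sy] := interlaced_sorted zy.
have [szy hzy hyz] := zy.
rewrite -szy; apply: prod_XsubC_sign_nth => [|j jk|j /andP[kj js]]; first by rewrite szy.
  by rewrite (le_lt_trans _ (hzy _ ks))// le_nth_mono ?szy ?ks ?andbT.
by rewrite (lt_le_trans (hyz k _)) ?le_nth_mono ?kj// -szy (leq_ltn_trans kj).
Qed.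

(** The pencil has opposite signs at [zs_k] and [ys_k], hence one zero between them. As the new list
    again interlaces with [zs], the lemma can be iterated, which yields monotonicity in [N]. *)
Lemma interlaced_pencil zs ys (t : R) : interlaced zs ys -> 0 < t ->
  exists w, [/\ interlaced zs w, size w = size ys,
    forall k, (k < size ys)%N -> w`_k < ys`_k &
    \prod_(y <- ys) ('X - y%:P) + t *: \prod_(z <- zs) ('X - z%:P) =
      (1 + t) *: \prod_(x <- w) ('X - x%:P)].
Proof.
move=> zy t0; have [szy hzy hyz] := zy.
set Y := \prod_(y <- ys) _; set Z := \prod_(z <- zs) _.
have sY : size Y = (size ys).+1 by rewrite size_prod_XsubC.
have sZ : size Z = (size ys).+1 by rewrite size_prod_XsubC szy.
(* Both products are monic of the same degree, so the pencil keeps that degree when [1 + t] is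
   nonzero. *)
have cF : (Y + t *: Z)`_(size ys) = 1 + t.
  rewrite coefD coefZ -{1}[size ys]/((size ys).+1.-1) -{1}sY -lead_coefE.
  rewrite -{1}[size ys]/((size ys).+1.-1) -{1}sZ -lead_coefE.
  by rewrite !(eqP (monic_prod_XsubC _ _ _)) mulr1.
have t1 : 1 + t != 0 by rewrite gt_eqF// addr_gt0.
have sF : size (Y + t *: Z) = (size ys).+1.
  apply/eqP; rewrite eqn_leq; apply/andP; split.
    by rewrite (leq_trans (size_polyD _ _))// geq_max sY leqnn (leq_trans (size_scale_leq _ _))// sZ.
  by rewrite ltnNge; apply/negP => /leq_sizeP/(_ _ (leqnn _))/eqP; rewrite cF; exact/negP.
have [|||w [sw ssw FE hw]] :=
   @zero_list_of_sign_changes (Y + t *: Z) (size ys) (nth 0 zs) (nth 0 ys) sF.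
- exact: hzy.
- by move=> k ks; apply/ltW/hyz.
- move=> k ks.
  (* At [zs_k] the pencil reduces to [Y], at [ys_k] to [t *: Z]; the number of zeros to the right
     gives each sign. *)
  apply: (@signs_neq (size ys - k.+1)).
    rewrite -subSn// subSS.
    have -> : (Y + t *: Z).[zs`_k] = Y.[zs`_k].
      have /eqP Z0 : root Z zs`_k by rewrite root_prod_XsubC mem_nth// szy.
      by rewrite hornerD hornerZ Z0 mulr0 addr0.
    exact: interlaced_sign_left.
  have -> : (Y + t *: Z).[ys`_k] = t * Z.[ys`_k].
    have /eqP Y0 : root Y ys`_k by rewrite root_prod_XsubC mem_nth.
    by rewrite hornerD hornerZ Y0 add0r.
  by rewrite mulrCA mulr_gt0// interlaced_sign_right.
exists w; split => //.
- split; rewrite ?sw//.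
    by move=> k /hw/andP[].
  move=> k ks; have /andP[_ h] := hw k (ltnW ks).
  by rewrite (lt_trans h) ?hyz.
- by move=> k /hw/andP[].
- by rewrite FE lead_coefE sF /= cF.
Qed.

End RootLists.

(** * Orthogonality to lower degrees and location of the zeros *)

Section Orthogonality.
Set Implicit Arguments. Unset Strict Implicit.
Context {R : realType}.
Implicit Types (p q f g : {poly R}).

(** Induction on the degree of [g]: subtracting the multiple of the monic [P m] with the same top
    coefficient lowers the degree. *)
Lemma MOPS_orthogonal (ip : {poly R} -> {poly R} -> R) (P : nat -> {poly R}) :
  (forall f, scalar (ip f)) -> is_MOPS ip P ->
  forall n g, (size g <= n)%N -> ip (P n) g = 0.
Proof.
move=> ip_lin hP n g.
have ip0 f : ip f 0 = 0 by have := ip_lin f (-1) 0 0; rewrite scaler0 addr0 mulN1r addNr.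
move: {2}(size g) (leqnn (size g)) => m; elim: m g => [|m IH] g gm gn.
  by move: gm; rewrite leqn0 size_poly_eq0 => /eqP ->.
have [{}gm|mg] := leqP (size g) m; first exact: IH.
have {mg}gm : size g = m.+1 by apply/eqP; rewrite eqn_leq gm.
have [mP [sP [_ _]]] := hP m.
have [_ [_ [_ oP]]] := hP n.
rewrite -[g](subrK (g`_m *: P m)) addrC ip_lin oP; last by rewrite ltn_eqF// -gm.
rewrite mulr0 add0r.
suff h : (size (g - g`_m *: P m)%R <= m)%N.
  by apply: IH => //; apply: leq_trans h _; rewrite ltnW// -gm.
apply/leq_sizeP => j; rewrite leq_eqVlt coefB coefZ => /predU1P[<-|mj].
  have -> : (P m)`_m = 1 by move: mP; rewrite monicE lead_coefE sP => /eqP.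
  by rewrite mulr1 subrr.
have -> : g`_j = 0 by apply: nth_default; rewrite gm.
by have -> : (P m)`_j = 0; [apply: nth_default; rewrite sP | rewrite mulr0 subr0].
Qed.

(** The strict inequality for every nonzero [p] is where the infinite support of the measure
    enters. *)
Definition positive_on (a b : R) (L : {poly R} -> R) :=
  forall p, p != 0 -> (forall x, a <= x <= b -> 0 <= p.[x]) -> 0 < L p.

(** The list [s] collects the zeros of odd multiplicity in []a, b[]. Peeling off one zero [r] at a
    time toggles its membership in [s], so that [p] times the product has only even zeros there. *)
Lemma fixed_sign_factor (a b : R) p : p != 0 ->
  exists s, [/\ uniq s, all (fun x => a < x < b) s,
    \prod_(x <- s) ('X - x%:P) %| p &
    exists e : bool, forall x, a <= x <= b ->
      0 <= (-1) ^+ e * (p * \prod_(x <- s) ('X - x%:P)).[x]].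
Proof.
move: {2}(size p) (leqnn (size p)) => m; elim: m p => [|m IH] p pm p0.
  by move: pm p0; rewrite leqn0 size_poly_eq0 => /eqP ->; rewrite eqxx.
have [[r rab /factor_theorem[q pE]]|nor] := pselect (exists2 r, a < r < b & root p r).
  have q0 : q != 0 by apply: contraNneq p0 => q0; rewrite pE q0 mul0r.
  have qm : (size q <= m)%N.
    by move: pm; rewrite pE size_Mmonic ?monicXsubC// size_XsubC addn2.
  have [s [us sab sq [e he]]] := IH q qm q0.
  have [rs|rs] := boolP (r \in s).
    exists (rem r s); split.
    - exact: rem_uniq.
    - by apply/allP => x /mem_rem xs; exact: (allP sab).
    - rewrite pE; apply: dvdp_mulr; apply: dvdp_trans sq.
      by rewrite (perm_big _ (perm_to_rem rs))/= big_cons dvdp_mull.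
    - exists e => x xab; have := he x xab.
      by rewrite (perm_big _ (perm_to_rem rs))/= big_cons pE mulrA.
  exists (r :: s); split => /=.
  - by rewrite rs.
  - by rewrite rab.
  - by rewrite big_cons pE mulrC dvdp_mul.
  - exists e => x xab; rewrite big_cons pE.
    have -> : q * ('X - r%:P) * (('X - r%:P) * \prod_(j <- s) ('X - j%:P)) =
       ('X - r%:P) ^+ 2 * (q * \prod_(j <- s) ('X - j%:P)) by rewrite expr2; ring.
    by rewrite hornerM mulrCA mulr_ge0 ?he// horner_exp sqr_ge0.
exists [::]; split => //; rewrite big_nil ?dvd1p// mulr1.
(* With no zero left in []a, b[], a sign change on [[a, b]] would contradict the intermediate value
   theorem. *)
have sg u v : a <= u -> u <= v -> v <= b -> 0 <= p.[u] * p.[v].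
  move=> au uv vb; rewrite leNgt; apply/negP => h.
  have [x] := poly_ivtoo uv h; rewrite in_itv/= => /andP[ux xv] px; apply: nor.
  by exists x => //; rewrite (le_lt_trans au)// (lt_le_trans xv).
have sg' u v : a <= u <= b -> a <= v <= b -> 0 <= p.[u] * p.[v].
  by move=> /andP[? ?] /andP[? ?]; case/orP: (le_total u v) => ?; [|rewrite mulrC]; exact: sg.
have [[u uab pu]|h] := pselect (exists2 u, a <= u <= b & p.[u] < 0).
  by exists true => x xab; rewrite expr1 mulN1r oppr_ge0 -(nmulr_rge0 _ pu) sg'.
exists false => x xab; rewrite expr0 mul1r leNgt; apply/negP => px; apply: h.
by exists x.
Qed.

(** With fewer than [n] sign changes, the product [q] over them would have degree below [n], making
    [L (w * (p * q))] zero although [w p q] has a fixed sign. The weight [w] is [1] for [Q] and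
    [X - c] for [P]. *)
Lemma orthogonal_poly_splits (a b : R) (L : {scalar {poly R}}) (w p : {poly R}) n :
  positive_on a b L -> w != 0 -> (forall x, a <= x <= b -> 0 <= w.[x]) ->
  p \is monic -> size p = n.+1 ->
  (forall g, (size g <= n)%N -> L (w * (p * g)) = 0) ->
  exists s, [/\ sorted <%R s, size s = n, all (fun x => a < x < b) s &
    p = \prod_(x <- s) ('X - x%:P)].
Proof.
move=> Lpos w0 wge0 mp sp orth.
have p0 : p != 0 by exact: monic_neq0.
have [s [us sab sdvd [e he]]] := fixed_sign_factor a b p0.
set q := \prod_(x <- s) _ in sdvd he.
have q0 : q != 0 by rewrite monic_neq0// monic_prod_XsubC.
have sq : size q = (size s).+1 by rewrite size_prod_XsubC.
have ssn : size s = n.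
  apply/eqP; rewrite eqn_leq; apply/andP; split.
    by rewrite -ltnS -sq -sp dvdp_leq.
  rewrite leqNgt; apply/negP => sn.
  have : 0 < L ((-1) ^+ e *: (w * (p * q))).
    apply: Lpos => [|x xab].
      by rewrite scaler_eq0 !mulf_eq0 signr_eq0 !negb_or w0 p0 q0.
    by rewrite hornerZ hornerM mulrCA mulr_ge0 ?wge0// he.
  by rewrite linearZ/= orth ?mulr0 ?ltxx// sq.
exists (sort <=%R s); split.
- by rewrite sort_lt_sorted.
- by rewrite size_sort.
- by rewrite all_sort.
- rewrite (perm_big _ (permEl (perm_sort _ _))) /= -/q.
  have : q %= p by rewrite -dvdp_size_eqp// sq sp ssn.
  by rewrite eqp_monic ?monic_prod_XsubC// => /eqP.
Qed.

End Orthogonality.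

(** * The kernel polynomial [G], interlacing, and the pencil for the added mass *)

Section ChristoffelGeronimus.
Set Implicit Arguments. Unset Strict Implicit.
Context {R : realType} (L : {scalar {poly R}}) (a b c : R) (n : nat) (Q P P1 : {poly R}).
Context (Lpos : positive_on a b L) (ca : c < a)
  (mQ : Q \is monic) (sQ : size Q = n.+2)
  (Q_orth : forall g : {poly R}, (size g <= n.+1)%N -> L (Q * g) = 0)
  (mP : P \is monic) (sP : size P = n.+1)
  (P_orth : forall g : {poly R}, (size g <= n)%N -> L (('X - c%:P) * (P * g)) = 0)
  (mP1 : P1 \is monic) (sP1 : size P1 = n.+1)
  (P1_orth : forall g : {poly R}, (size g <= n)%N -> L (('X - c%:P) ^+ 2 * (P1 * g)) = 0).

Local Notation G := (('X - c%:P) * P1).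
Local Notation kappa := (L G).
Let B := - Q.[c] * P.[c] / L (('X - c%:P) * (P * P)).

Let mG : G \is monic. Proof. by rewrite monicMl ?monicXsubC. Qed.

Let sG : size G = n.+2.
Proof. by rewrite size_monicM ?monicXsubC ?monic_neq0// size_XsubC sP1. Qed.

(** Write [f = f(c) + (x - c) h]: the part with [h] dies by orthogonality of [P1] for [(x - c)^2 L],
    since [h] has degree below [n]. *)
Lemma kernel_reproducing (f : {poly R}) : (size f <= n.+1)%N -> L (G * f) = kappa * f.[c].
Proof.
move=> sf; have /factor_theorem[h fE] : root (f - f.[c]%:P) c.
  by rewrite /root !hornerE subrr.
have sh : (size h <= n)%N.
  have [->|h0] := eqVneq h 0; first by rewrite size_poly0.
  have := size_Mmonic h0 (monicXsubC c); rewrite -fE size_XsubC addn2 /= => e.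
  by rewrite -ltnS -e (leq_trans (size_polyD _ _))// geq_max size_polyN sf (leq_trans (size_polyC_leq1 _)).
have {1}-> : f = h * ('X - c%:P) + f.[c]%:P by rewrite -fE subrK.
rewrite mulrDr linearD/=.
have -> : G * (h * ('X - c%:P)) = ('X - c%:P) ^+ 2 * (P1 * h) by ring.
by rewrite P1_orth// add0r mulrC mul_polyC linearZ/= mulrC.
Qed.

Let XsubC_pos x : a <= x <= b -> 0 < ('X - c%:P).[x].
Proof. by case/andP=> ax _; rewrite !hornerE subr_gt0 (lt_le_trans ca). Qed.

Lemma P_norm_gt0 : 0 < L (('X - c%:P) * (P * P)).
Proof.
apply: Lpos => [|x xab]; first by rewrite !mulf_neq0 ?polyXsubC_eq0 ?monic_neq0.
rewrite hornerM; apply: mulr_ge0; first exact/ltW/XsubC_pos.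
by rewrite hornerM -expr2 sqr_ge0.
Qed.

(** Take [f = P] in the reproducing property; replacing [P1] by [P] costs nothing, as [P1 - P] has
    degree below [n]. *)
Lemma kappa_eq : kappa * P.[c] = L (('X - c%:P) * (P * P)).
Proof.
rewrite -kernel_reproducing ?sP//.
have -> : G * P = ('X - c%:P) * (P * P) + ('X - c%:P) * (P * (P1 - P)) by ring.
rewrite linearD/= (P_orth (g := P1 - P)) ?addr0//.
apply/leq_sizeP => j; rewrite leq_eqVlt coefB => /predU1P[<-|mj].
  by move: mP mP1; rewrite !monicE !lead_coefE sP sP1 => /eqP -> /eqP ->; rewrite subrr.
have -> : P1`_j = 0 by apply: nth_default; rewrite sP1.
by have -> : P`_j = 0; [apply: nth_default; rewrite sP | rewrite subrr].
Qed.

Let Pc_neq0 : P.[c] != 0.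
Proof. by apply/eqP => Pc; have := P_norm_gt0; rewrite -kappa_eq Pc mulr0 ltxx. Qed.

Let kappa_neq0 : kappa != 0.
Proof. by apply/eqP => k0; have := P_norm_gt0; rewrite -kappa_eq k0 mul0r ltxx. Qed.

Lemma B_kappa : B * kappa = - Q.[c].
Proof.
rewrite /B -kappa_eq; move: Pc_neq0 kappa_neq0; move: kappa P.[c] Q.[c] => k p q p0 k0.
by field; rewrite p0 k0.
Qed.

(** The polynomial [r(y) G - G(y) r] is [(x - y) h]; multiplied by [r] it becomes [Q h], which [L]
    kills. The reproducing property evaluates [L (G * r)]. *)
Lemma node_value (y : R) (r : {poly R}) : Q = ('X - y%:P) * r -> r.[y] != 0 ->
  G.[y] * L (r * r) = kappa * r.[c] * r.[y].
Proof.
move=> QE ry.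
have mr : r \is monic by move: mQ; rewrite QE monicMl ?monicXsubC.
have sr : size r = n.+1.
  by move: sQ; rewrite QE size_monicM ?monicXsubC ?monic_neq0// size_XsubC add2n /= => -[].
rewrite -kernel_reproducing ?sr//.
have /factor_theorem[h hE] : root (r.[y] *: G - G.[y] *: r) y.
  by rewrite /root hornerD hornerN !hornerZ mulrC subrr.
have sh : (size h <= n.+1)%N.
  have [->|h0] := eqVneq h 0; first by rewrite size_poly0.
  have := size_Mmonic h0 (monicXsubC y); rewrite -hE size_XsubC addn2 /= => e.
  rewrite -ltnS -e (leq_trans (size_polyD _ _))// geq_max size_polyN.
  by rewrite !(leq_trans (size_scale_leq _ _))// ?sG ?sr.
have -> : L (G * r) * r.[y] = L (r.[y] *: (G * r)) by rewrite linearZ/= mulrC.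
have -> : r.[y] *: (G * r) = Q * h + G.[y] *: (r * r).
  have -> : r.[y] *: (G * r) = (r.[y] *: G - G.[y] *: r) * r + G.[y] *: (r * r).
    by rewrite -!mul_polyC; ring.
  by rewrite hE QE; congr (_ + _); ring.
by rewrite linearD/= Q_orth// add0r linearZ.
Qed.

Lemma christoffel_interlacing : exists ys xs,
  [/\ Q = \prod_(y <- ys) ('X - y%:P), P1 = \prod_(x <- xs) ('X - x%:P),
      size ys = n.+1 & interlaced (c :: xs) ys] /\ 0 < B.
Proof.
have onepos x : a <= x <= b -> 0 <= (1 : {poly R}).[x] by rewrite hornerE.
have [ys [ssy sy yab QE]] :
    exists s, [/\ sorted <%R s, size s = n.+1, all (fun x => a < x < b) s &
      Q = \prod_(x <- s) ('X - x%:P)].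
  by apply: (orthogonal_poly_splits (w := 1) Lpos); rewrite ?oner_neq0// => g sg; rewrite mul1r Q_orth.
have [ps [_ sp pab PE]] :
    exists s, [/\ sorted <%R s, size s = n, all (fun x => a < x < b) s &
      P = \prod_(x <- s) ('X - x%:P)].
  apply: (orthogonal_poly_splits (w := 'X - c%:P) Lpos) => //.
    by rewrite polyXsubC_eq0.
  by move=> x /XsubC_pos/ltW.
have cy : all (> c) ys by apply/allP => y /(allP yab)/andP[ay _]; exact: lt_trans ay.
have cp : all (> c) ps by apply/allP => y /(allP pab)/andP[ay _]; exact: lt_trans ay.
have hQ : 0 < (-1) ^+ n.+1 * Q.[c] by rewrite QE -sy; exact: prod_XsubC_sign.
have hP : 0 < (-1) ^+ n * P.[c] by rewrite PE -sp; exact: prod_XsubC_sign.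
have B0 : 0 < B.
  by rewrite /B divr_gt0 ?P_norm_gt0// mulNr oppr_gt0 (@signs_neq _ n).
(* [kappa] has the sign of [P(c)], their product being a squared norm. *)
have kn : 0 < (-1) ^+ n * kappa.
  rewrite -(pmulr_lgt0 _ hP).
  have -> : (-1) ^+ n * kappa * ((-1) ^+ n * P.[c]) = ((-1) ^+ n) ^+ 2 * (kappa * P.[c]).
    by ring.
  by rewrite sqrr_sign mul1r kappa_eq P_norm_gt0.
(* Apply [node_value] to the cofactor [r = r1 * r2] of [X - y]. The signs [(-1)^n] of [kappa] and
   [r(c)] cancel, leaving that of [r(y)], fixed by the [n - k] zeros right of [y]. *)
have hG k : (k < n.+1)%N -> 0 < (-1) ^+ (n - k) * P1.[ys`_k].
  move=> kn1; set y := ys`_k.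
  pose s1 := take k ys; pose s2 := drop k.+1 ys.
  have ysE : ys = s1 ++ y :: s2 by rewrite -drop_nth ?sy// cat_take_drop.
  pose r1 := \prod_(x <- s1) ('X - x%:P); pose r2 := \prod_(x <- s2) ('X - x%:P).
  have Qr : Q = ('X - y%:P) * (r1 * r2).
    by rewrite QE {1}ysE big_cat big_cons /= mulrCA.
  have ss1 : size s1 = k by rewrite size_takel// sy ltnW.
  have r1y : 0 < r1.[y].
    apply/prod_XsubC_gt0/(all_nthP 0) => j.
    by rewrite ss1 => jk /=; rewrite nth_take// lt_nth_mono// jk sy.
  have ss2 : size s2 = (n - k)%N by rewrite size_drop sy subSS.
  have r2y : 0 < (-1) ^+ (n - k) * r2.[y].
    rewrite -ss2; apply/prod_XsubC_sign/(all_nthP 0) => j.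
    rewrite ss2 => js /=; rewrite nth_drop lt_nth_mono// sy addSn ltnS leq_addr ltnS.
    by rewrite -ltn_subRL.
  have ry : 0 < (-1) ^+ (n - k) * (r1 * r2).[y] by rewrite hornerM mulrCA mulr_gt0.
  have rc : 0 < (-1) ^+ n * (r1 * r2).[c].
    have -> : r1 * r2 = \prod_(x <- s1 ++ s2) ('X - x%:P) by rewrite big_cat.
    have -> : n = size (s1 ++ s2).
      by rewrite size_cat ss1 ss2 subnKC// -ltnS.
    by apply: prod_XsubC_sign; move: cy; rewrite ysE !all_cat/= => /and3P[-> _ ->].
  have r0 : (r1 * r2).[y] != 0.
    by apply/eqP => e; rewrite e mulr0 ltxx in ry.
  have Lr : 0 < L (r1 * r2 * (r1 * r2)).
    apply: Lpos => [|x _]; last by rewrite hornerM -expr2 sqr_ge0.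
    by rewrite mulf_neq0//; apply: contraNneq r0 => ->; rewrite horner0.
  have yc : 0 < ('X - c%:P).[y].
    apply: XsubC_pos; have /andP[? ?] : a < y < b by apply: (allP yab); rewrite mem_nth ?sy.
    by rewrite !ltW.
  rewrite -(pmulr_lgt0 _ yc) -(pmulr_lgt0 _ Lr).
  have -> : (-1) ^+ (n - k) * P1.[y] * ('X - c%:P).[y] * L (r1 * r2 * (r1 * r2)) =
     (-1) ^+ (n - k) * (G.[y] * L (r1 * r2 * (r1 * r2))) by rewrite hornerM; ring.
  rewrite (node_value Qr r0).
  have := mulr_gt0 (mulr_gt0 kn rc) ry.
  have -> : (-1) ^+ n * kappa * ((-1) ^+ n * (r1 * r2).[c]) * ((-1) ^+ (n - k) * (r1 * r2).[y])
    = ((-1) ^+ n) ^+ 2 * ((-1) ^+ (n - k) * (kappa * (r1 * r2).[c] * (r1 * r2).[y])).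
    by ring.
  by rewrite sqrr_sign mul1r.
(* [P1] has degree [n] and alternates in sign over the [n + 1] zeros of [Q]: one zero per gap. *)
have [|||xs [sx ssx P1E hx]] :=
   @zero_list_of_sign_changes _ P1 n (fun k => ys`_k) (fun k => ys`_k.+1) sP1.
- by move=> k kn'; rewrite lt_nth_mono// sy ltnSn ltnS.
- by [].
- move=> k kn'; apply: (@signs_neq _ (n - k.+1)).
    by rewrite -subSn// subSS hG// ltnW.
  exact: hG.
exists ys, xs; split=> //; split=> //.
  by rewrite P1E (eqP mP1) scale1r.
split => /=.
- by rewrite sx sy.
- rewrite sy => -[_|k kn']/=; last by have /andP[] := hx k kn'.
  by apply: (allP cy); rewrite mem_nth ?sy.
- by rewrite sy => k kn'; have /andP[] := hx k kn'.
Qed.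

(** The leading terms cancel in the difference [D] of the two sides, so [D] may be used as a test
    polynomial for [Q], [G] and [QN]. This makes its square norm with the added mass zero, and
    positivity forces [D = 0]. *)
Lemma uvarov_pencil (N : R) (QN : {poly R}) : 0 < N -> 0 < B ->
  QN \is monic -> size QN = n.+2 ->
  (forall g : {poly R}, (size g <= n.+1)%N -> L (QN * g) + N * QN.[c] * g.[c] = 0) ->
  Q + (N * B) *: G = (1 + N * B) *: QN.
Proof.
move=> N0 B0 mQN sQN oQN; set t := N * B.
have t1 : 0 < 1 + t by rewrite addr_gt0// mulr_gt0.
apply/eqP; rewrite -subr_eq0; set D := _ - _; apply/eqP.
have sD : (size D <= n.+1)%N.
  apply/leq_sizeP => j; rewrite leq_eqVlt coefB coefD !coefZ => /predU1P[<-|mj].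
    move: mQ mQN mG; rewrite !monicE !lead_coefE sQ sQN sG => /eqP -> /eqP -> /eqP ->.
    by rewrite !mulr1 subrr.
  have z f : size f = n.+2 -> f`_j = 0 by move=> sf; apply: nth_default; rewrite sf.
  by rewrite !z// !mulr0 addr0 subrr.
apply/eqP/negPn/negP => D0.
have : 0 < L (D * D) + N * D.[c] * D.[c].
  have DD : 0 < L (D * D).
    apply: Lpos => [|x _]; first by rewrite mulf_neq0.
    by rewrite hornerM -expr2 sqr_ge0.
  by rewrite (lt_le_trans DD)// lerDl -mulrA -expr2 mulr_ge0 ?sqr_ge0// ltW.
suff -> : L (D * D) + N * D.[c] * D.[c] = 0 by rewrite ltxx.
have -> : D * D = Q * D + t *: (G * D) - (1 + t) *: (QN * D).
  by rewrite {1}/D -!mul_polyC; ring.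
rewrite linearB linearD !linearZ/= Q_orth// kernel_reproducing//.
have Dc : D.[c] = Q.[c] - (1 + t) * QN.[c].
  have -> : Q.[c] = (Q + t *: G).[c].
    by rewrite hornerD hornerZ hornerM hornerXsubC subrr mul0r mulr0 addr0.
  by rewrite -hornerZ -hornerN -hornerD.
have hQN := oQN D sD.
(* The coefficient [N * B] of [G] is chosen for this identity: it makes [L (D * D)] equal to
   [- N D(c)^2]. *)
have tk : t * kappa = - (N * Q.[c]) by rewrite /t -mulrA B_kappa mulrN.
rewrite add0r mulrA tk {2}Dc.
have -> : L (QN * D) = - (N * QN.[c] * D.[c]) by apply/eqP; rewrite -addr_eq0 hQN.
by rewrite -[_ *: _]/(_ * _); ring.
Qed.

End ChristoffelGeronimus.

(** * The measure [dmu / (x - c)] as a positive linear functional *)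

Section PositiveFunctional.
Set Implicit Arguments. Unset Strict Implicit.
Context {R : realType} (mu : {measure set (measurableTypeR R) -> \bar R}).

(** A point outside the support lies in a null interval with rational endpoints, and there are
    countably many of these. [F] enumerates them through [unpickle], with [set0] for the other
    codes. *)
Lemma negligible_setC_msupport : mu.-negligible (~` msupport mu).
Proof.
pose J (q : rat * rat) : set (measurableTypeR R) := `]ratr q.1, ratr q.2[%classic.
pose F (k : nat) := if unpickle k is Some q then
  (if `[< mu (J q) = 0 >]%E then J q else set0) else set0.
apply: (@negligibleS _ _ _ _ (\bigcup_k F k)); last first.
  apply: negligible_bigcup => k; rewrite /F; case: unpickle => [q|]; last exact: negligible_set0.
  case: asboolP => [Jq0|_]; last exact: negligible_set0.
  by apply/negligibleP => //; exact: measurable_itv.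
move=> x /= /existsNP[e /not_implyP[e0 muxe]].
have {}muxe : mu (ball x e) = 0%E.
  by apply/eqP; rewrite eq_le measure_ge0 andbT leNgt; exact/negP.
have [q1] := @rat_in_itvoo R (x - e) x ltac:(by rewrite ltrBlDr ltrDl).
rewrite in_itv/= => /andP[q1l q1r].
have [q2] := @rat_in_itvoo R x (x + e) ltac:(by rewrite ltrDl).
rewrite in_itv/= => /andP[q2l q2r].
exists (pickle (q1, q2)); [exact: I|rewrite /F pickleK].
have -> : `[< mu (J (q1, q2)) = 0%E >].
  apply/asboolP/eqP; rewrite eq_le measure_ge0 andbT -muxe le_measure ?inE//.
  - exact: measurable_itv.
  - by rewrite ball_itv; exact: measurable_itv.
  rewrite ball_itv => y; rewrite /J /= !in_itv/= => /andP[h1 h2].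
  by rewrite (lt_trans q1l)// (lt_trans h2).
by rewrite /J /= in_itv/= q1r q2l.
Qed.

Context (a b c : R).
Context (fin_mu : (mu setT < +oo)%E) (supp_ab : msupport mu `<=` `[a, b])
  (supp_inf : ~ finite_set (msupport mu)) (ca : c < a).

Local Notation D := (`[a, b]%classic : set (measurableTypeR R)).

Lemma measure_setC_itv : mu (~` D) = 0%E.
Proof.
apply: measure_negligible; first by apply: measurableC; exact: measurable_itv.
by apply: negligibleS negligible_setC_msupport; exact: subsetC.
Qed.

(** The complement of [[a, b]] is null, so [h] may be unbounded there, as [(x - c)^-1] is near
    [c]. *)
Lemma integrable_of_bounded_itv (h : R -> R) : measurable_fun (setT : set (measurableTypeR R)) h ->
  [bounded h x | x in D] -> mu.-integrable setT (EFin \o h).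
Proof.
move=> mh bh; have mD : measurable D by exact: measurable_itv.
have DC : setT `\` ~` D = D by rewrite setTD setCK.
have muD : (mu D < +oo)%E.
  by rewrite (le_lt_trans _ fin_mu)// le_measure ?inE.
have mhD : measurable_fun D h by apply: measurable_funTS.
have /integrableP[_ fi] := measurable_bounded_integrable mD muD mhD bh.
apply/integrableP; split; first exact/measurable_EFinP.
rewrite (@ge0_negligible_integral _ _ _ _ _ (~` D))// ?DC//.
- exact: measurableC.
- by apply: measurableT_comp => //; exact/measurable_EFinP.
- exact: measure_setC_itv.
Qed.

Lemma continuous_within_inv_sub :
  {within D, continuous (fun x : R => (x - c)^-1)}.
Proof.
apply: continuous_in_subspaceT => x; rewrite inE/= in_itv/= => /andP[ax _].
apply: cvgV; first by rewrite subr_eq0 gt_eqF// (lt_le_trans ca).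
by apply: cvgB; [exact: cvg_id | exact: cvg_cst].
Qed.

Lemma measurable_inv_sub :
  measurable_fun (setT : set (measurableTypeR R)) (fun x : R => (x - c)^-1).
Proof.
have o : open [set x : R | x != c] by exact: open_neq.
(* The inverse is continuous only away from [c]; the singleton is treated apart. *)
have -> : (setT : set (measurableTypeR R)) = [set x | x != c] `|` [set c].
  apply/seteqP; split=> x //= _; have [->|] := eqVneq x c; [by right|by left].
apply/measurable_funU; [exact: open_measurable | exact: measurable_set1 | split].
  apply: open_continuous_measurable_fun => // x; rewrite inE /= => xc.
  apply: cvgV; first by rewrite subr_eq0.
  by apply: cvgB; [exact: cvg_id | exact: cvg_cst].
exact: measurable_fun_set1.
Qed.

Definition geronimus (p : {poly R}) : R := \int[mu]_x (p.[x] * (x - c)^-1).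

Lemma integrable_geronimus (p : {poly R}) :
  mu.-integrable setT (EFin \o (fun x : R => p.[x] * (x - c)^-1)).
Proof.
apply: integrable_of_bounded_itv.
  apply: measurable_funM; last exact: measurable_inv_sub.
  exact: measurable_poly.
have cf : {within D, continuous (fun x : R => p.[x] * (x - c)^-1)}.
  move=> x; apply: cvgM; last exact: continuous_within_inv_sub.
  by apply: continuous_subspaceT; exact: continuous_horner.
have := compact_bounded (continuous_compact cf (@segment_compact _ a b)).
case=> M [Mr h]; exists M; split => // r Mr' x Dx; apply: (h r Mr').
by exists x.
Qed.

Lemma geronimus_is_scalar : scalar geronimus.
Proof.
move=> k p q; rewrite /geronimus.
rewrite -RintegralZl//; last exact: integrable_geronimus.
rewrite -RintegralD//; last exact: integrable_geronimus.
  by apply: eq_Rintegral => x _; rewrite hornerD hornerZ mulrDl mulrA.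
apply: eq_integrable (integrableZl measurableT k (integrable_geronimus p)) => //.
Qed.

(** Weights that agree on [[a, b]] agree almost everywhere. With [r] equal to [1], [X - c] and
    [(X - c)^2] this covers [nu_ip], [mu_ip] and [mu1_ip]. *)
Lemma geronimus_weight (w : R -> R) (r : {poly R}) :
  measurable_fun (setT : set (measurableTypeR R)) w ->
  (forall x, x \in `[a, b] -> w x = r.[x] * (x - c)^-1) ->
  forall f g, wip mu w f g = geronimus (r * (f * g)).
Proof.
move=> mw wr f g; rewrite /wip /geronimus /Rintegral; congr fine.
apply: ae_eq_integral => //.
- apply/measurable_EFinP; apply: measurable_funM => //.
  by apply: measurable_funM; exact: measurable_poly.
- have /integrableP[] := integrable_geronimus (r * (f * g)); by [].
exists (~` D); split.
- by apply: measurableC; exact: measurable_itv.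
- exact: measure_setC_itv.
move=> x /= h xD; apply: h => _.
by rewrite wr// !hornerM; congr EFin; ring.
Qed.

(** A zero integral of the nonnegative [h] makes [h] vanish almost everywhere on [[a, b]]. But [p]
    has finitely many roots, so it is nonzero near some support point, on a ball of positive
    measure. *)
Lemma geronimus_positive : positive_on a b geronimus.
Proof.
move=> p p0 pge0.
pose h x := p.[x] * (x - c)^-1.
have hge0 x : D x -> 0 <= h x.
  rewrite /= in_itv/= => xab; rewrite mulr_ge0 ?pge0// invr_ge0 subr_ge0.
  by have /andP[ax _] := xab; rewrite (le_trans (ltW ca)).
have mD : measurable D by exact: measurable_itv.
have ih := integrable_geronimus p.
have DC : setT `\` ~` D = D by rewrite setTD setCK.
have GE : geronimus p = \int[mu]_(x in D) h x.
  rewrite /geronimus /Rintegral; congr fine.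
  rewrite (@negligible_integral _ _ _ _ _ (~` D)) ?DC//; first exact: measurableC.
  exact: measure_setC_itv.
have ihD : mu.-integrable D (EFin \o h) by apply: integrableS ih.
have G0 : 0 <= geronimus p by rewrite GE; apply: Rintegral_ge0.
rewrite lt_neqAle G0 andbT eq_sym; apply/eqP => pz.
have mh : measurable_fun D (EFin \o h) by have /integrableP[] := ihD.
have I0 : (\int[mu]_(x in D) `|(EFin \o h) x| = 0)%E.
  have -> : (\int[mu]_(x in D) `|(EFin \o h) x| = \int[mu]_(x in D) (h x)%:E)%E.
    by apply: eq_integral => x; rewrite inE => xD; rewrite /= ger0_norm ?hge0.
  move: pz; rewrite GE /Rintegral => /eqP; rewrite fine_eq0.
    by move/eqP.
  exact: integrable_fin_num ihD.
have [N [mN muN0 hN]] := (ae_eq_integral_abs mu mD mh).1 I0.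
have [x0 sx0 px0] : exists2 x0, msupport mu x0 & ~~ root p x0.
  apply: contrapT => H; apply: supp_inf.
  have [s hs] : exists s : seq R, forall x, root p x -> x \in s.
    by exists (rootsR p) => x rx; rewrite -(roots_on_rootsR p0) in_itv.
  apply: sub_finite_set (finite_seq s) => x sx /=; apply: hs.
  by apply: contrapT => /negP rx; apply: H; exists x.
have : \forall x \near x0, p.[x] != 0.
  exact: (cvgr_neq0 p.[x0] (@continuous_horner _ p x0) px0).
case=> e /= e0 he.
have := sx0 e e0.
suff -> : mu (ball x0 e) = 0%E by rewrite ltxx.
have mB : measurable (ball x0 e : set (measurableTypeR R)).
  by rewrite ball_itv; exact: measurable_itv.
apply: measure_negligible => //.
apply: (@negligibleS _ _ _ _ (N `|` ~` D)).
  move=> x xB; have [xD|xD] := pselect (D x); [left|by right].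
  apply: hN => /= /(_ xD)[] /eqP; apply/negP; rewrite mulf_neq0 ?he//.
  move: xD; rewrite /= in_itv/= => /andP[ax _].
  by rewrite invr_eq0 subr_eq0 gt_eqF// (lt_le_trans ca).
apply: negligibleU; apply/negligibleP => //; first exact: measurableC.
exact: measure_setC_itv.
Qed.

End PositiveFunctional.

(** * Limits and rates of convergence of the zeros of a pencil *)

Section Limits.
Set Implicit Arguments. Unset Strict Implicit.
Context {R : realType}.

(** Solving the root equation gives [N (w - z) = h(w)] with [h] continuous on [[z, y]]. An upper
    bound of [h] yields [w --> z], and continuity then gives the limit [h(z)]. *)
Lemma cvg_scaled_root (w : R -> R) (z y beta : R) (q g : {poly R}) :
  0 < beta -> (forall x, z <= x <= y -> g.[x] != 0) ->
  (forall N, 0 < N -> z < w N < y) ->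
  (forall N, 0 < N -> q.[w N] + N * beta * ((w N - z) * g.[w N]) = 0) ->
  (w @ +oo --> z) /\
  ((fun N => N * (w N - z)) @ +oo --> - q.[z] / (beta * g.[z])).
Proof.
move=> beta0 g0 wzy wroot.
pose h x := - q.[x] / (beta * g.[x]).
have hc x : z <= x <= y -> {for x, continuous h}.
  move=> xzy; apply: cvgM.
    by apply: cvgN; exact: continuous_horner.
  apply: cvgV; first by rewrite mulf_neq0 ?g0// gt_eqF.
  by apply: cvgM; [exact: cvg_cst | exact: continuous_horner].
have hw N : 0 < N -> N * (w N - z) = h (w N).
  move=> N0; have /andP[w1 w2] := wzy N N0.
  have gw : g.[w N] != 0 by rewrite g0// !ltW.
  rewrite /h; have -> : q.[w N] = - (N * beta * ((w N - z) * g.[w N])).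
    by apply/eqP; rewrite -addr_eq0 wroot.
  by field; rewrite gw gt_eqF.
have zy : z <= y by have /andP[h1 h2] := wzy 1 ltr01; rewrite (le_trans (ltW h1))// ltW.
have hcw : {within `[z, y], continuous h}.
  by apply: continuous_in_subspaceT => x; rewrite inE/= in_itv/= => /hc.
have [K K0 hK] : exists2 K, 0 < K & forall x, z <= x <= y -> h x <= K.
  have [x1 _ h1] := EVT_max zy hcw.
  exists (Num.max 1 (h x1)); first by rewrite lt_max ltr01.
  by move=> x xzy; rewrite le_max h1 ?orbT// in_itv.
have wz : w @ +oo --> z.
  apply/cvgrPdist_lt => e e0; near=> N.
  have N0 : 0 < N by near: N; apply: nbhs_pinfty_gt; rewrite num_real.
  have /andP[w1 w2] := wzy N N0.
  rewrite distrC gtr0_norm ?subr_gt0//.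
  rewrite -(ltr_pM2l N0) hw// (le_lt_trans (hK _ _))//; first by rewrite !ltW.
  rewrite -ltr_pdivrMr//.
  by near: N; apply: nbhs_pinfty_gt; rewrite num_real.
split=> //.
have hz : h \o w @ +oo --> h z.
  by apply: continuous_cvg => //; apply: hc; rewrite lexx.
apply: cvg_trans hz; apply: near_eq_cvg; near=> N.
by rewrite /= hw//; near: N; apply: nbhs_pinfty_gt; rewrite num_real.
Unshelve. all: by end_near.
Qed.

(** Factor [g = (X - z) g1] with [z = zs_k]. Then [g'(z) = g1(z)], and interlacing keeps the zeros
    of [g1] out of [[z, ys_k]]. *)
Lemma cvg_pencil_root (zs ys : seq R) (beta : R) (w : R -> R) k :
  let q := \prod_(y <- ys) ('X - y%:P) in
  let g := \prod_(z <- zs) ('X - z%:P) in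
  interlaced zs ys -> 0 < beta -> (k < size ys)%N ->
  (forall N, 0 < N -> zs`_k < w N < ys`_k) ->
  (forall N, 0 < N -> root (q + (N * beta) *: g) (w N)) ->
  (w @ +oo --> zs`_k) /\
  ((fun N => N * (w N - zs`_k)) @ +oo --> - q.[zs`_k] / (beta * g^`().[zs`_k])).
Proof.
move=> q g zy beta0 ks wzy wroot.
have [sz sy] := interlaced_sorted zy; have [szy hzy hyz] := zy.
set z := zs`_k in wzy *.
pose s1 := take k zs; pose s2 := drop k.+1 zs.
have zsE : zs = s1 ++ z :: s2 by rewrite -drop_nth ?szy// cat_take_drop.
pose g1 := \prod_(x <- s1 ++ s2) ('X - x%:P).
have gE : g = ('X - z%:P) * g1.
  by rewrite /g {1}zsE /g1 !big_cat big_cons /= mulrCA.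
have -> : g^`().[z] = g1.[z].
  by rewrite gE derivM derivXsubC mul1r hornerD !hornerM hornerXsubC subrr mul0r addr0.
apply: (@cvg_scaled_root w z ys`_k) => //.
  move=> x /andP[zx xy]; change (~~ root g1 x); rewrite root_prod_XsubC mem_cat negb_or.
  apply/andP; split; apply/negP => /(nthP 0)[j].
    rewrite size_takel; last by rewrite szy ltnW.
    move=> jk; rewrite nth_take// => e.
    have : zs`_j < z by apply: lt_nth_mono; rewrite ?jk ?szy.
    by rewrite e ltNge zx.
  rewrite size_drop szy nth_drop => jk e.
  have js : (k.+1 + j < size ys)%N by rewrite -ltn_subRL.
  have : zs`_k.+1 <= x by rewrite -e le_nth_mono// leq_addr szy.
  rewrite leNgt (le_lt_trans xy)// hyz// (leq_trans _ js)// ltnS leq_addr//.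
move=> N N0; have /eqP := wroot N N0.
by rewrite hornerD hornerZ gE hornerM hornerXsubC.
Qed.

End Limits.

(** * Interlacing, monotonicity and limits for the zeros *)

Theorem theorem2 (R : realType) (mu : {measure set (measurableTypeR R) -> \bar R})
  (a b c : R)
  (P Q P1 : nat -> {poly R}) (QN : R -> nat -> {poly R}) (n : nat) :
  mu `<< (@lebesgue_measure R) ->
  (forall k : nat, mu.-integrable setT (fun x : R => (x ^+ k)%:E)) ->
  ~ finite_set (msupport mu) ->
  msupport mu `<=` `[a, b] -> a \in msupport mu -> b \in msupport mu ->
  c < a ->
  is_MOPS (mu_ip mu) P ->
  is_MOPS (nu_ip mu c) Q ->
  is_MOPS (mu1_ip mu c) P1 ->
  (forall N, 0 < N -> is_MOPS (nuN_ip mu c N) (QN N)) ->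
  (1 <= n)%N ->
  let B := - (Q n).[c] * (P n.-1).[c] / mu_ip mu (P n.-1) (P n.-1) in
  let y k := nth 0 (zeros (Q n)) k in
  let yN N k := nth 0 (zeros (QN N n)) k in
  let x k := nth 0 (zeros (P1 n.-1)) k in
  (* interlacing, for every N > 0 *)
  (forall N, 0 < N ->
     size (zeros (QN N n)) = n /\ size (zeros (Q n)) = n /\
     size (zeros (P1 n.-1)) = n.-1 /\
     c < yN N 0%N /\
     (forall k, (k < n)%N -> yN N k < y k) /\
     (forall k, (k < n.-1)%N -> y k < x k /\ x k < yN N k.+1)) /\
  (* each zero is a (strictly) decreasing function of N *)
  (forall k, (k < n)%N -> forall N1 N2, 0 < N1 -> N1 < N2 -> yN N2 k < yN N1 k) /\
  (* limits *)
  (yN^~ 0%N @ +oo --> c) /\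
  (forall k, (k < n.-1)%N -> yN^~ k.+1 @ +oo --> x k) /\
  ((fun N => N * (yN N 0%N - c)) @ +oo --> - (Q n).[c] / (B * (P1 n.-1).[c])) /\
  (forall k, (k < n.-1)%N ->
     (fun N => N * (yN N k.+1 - x k)) @ +oo -->
       - (Q n).[x k] / (B * (x k - c) * ((P1 n.-1)^`()).[x k])).
Proof.
move=> _ hint hinf hsub _ _ ca hP hQ hP1 hQN; case: n => // m _ /=.
(* The moment of order zero is the total mass. *)
have fin_mu : (mu setT < +oo)%E.
  have /integrableP[_] := hint 0%N.
  under eq_integral do rewrite expr0 /= normr1.
  by rewrite integral_cst// mul1e.
have mw := @measurable_inv_sub R c.
have [L LE] : exists L : {scalar {poly R}}, L = geronimus mu c :> (_ -> _).
  pose lin := GRing.isLinear.Build R {poly R} R *%R (geronimus mu c)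
    (geronimus_is_scalar fin_mu hsub ca).
  pose L : {scalar {poly R}} := HB.pack (geronimus mu c) lin.
  by exists L.
have Lpos : positive_on a b L by rewrite LE; exact: geronimus_positive.
have nuE f g : nu_ip mu c f g = L (f * g).
  rewrite -[f * g]mul1r LE; apply: (geronimus_weight fin_mu hsub ca) => // x _.
  by rewrite hornerE mul1r.
have xc x : x \in `[a, b] -> x - c != 0.
  by rewrite in_itv => /andP[ax _]; rewrite subr_eq0 gt_eqF// (lt_le_trans ca).
have muE f g : mu_ip mu f g = L (('X - c%:P) * (f * g)).
  rewrite LE; apply: (geronimus_weight fin_mu hsub ca) => // x /xc xc0.
  by rewrite hornerXsubC mulfV.
have mu1E f g : mu1_ip mu c f g = L (('X - c%:P) ^+ 2 * (f * g)).
  rewrite LE; apply: (geronimus_weight fin_mu hsub ca); first exact: measurable_funB.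
  by move=> x /xc xc0; rewrite horner_exp hornerXsubC expr2 mulfK.
have Llin (u f : {poly R}) : scalar (fun g => L (u * (f * g))).
  by move=> k g h; rewrite !mulrDr -!scalerAr linearP.
have lin_nu f : scalar (nu_ip mu c f).
  by move=> k g h; rewrite !nuE -[f * _]mul1r Llin !mul1r.
have Q_orth (g : {poly R}) : (size g <= m.+1)%N -> L (Q m.+1 * g) = 0.
  by move=> sg; rewrite -nuE (MOPS_orthogonal lin_nu hQ).
have P_orth (g : {poly R}) : (size g <= m)%N -> L (('X - c%:P) * (P m * g)) = 0.
  move=> sg; rewrite -muE (MOPS_orthogonal _ hP)//.
  by move=> f k p q; rewrite !muE Llin.
have P1_orth (g : {poly R}) : (size g <= m)%N -> L (('X - c%:P) ^+ 2 * (P1 m * g)) = 0.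
  move=> sg; rewrite -mu1E (MOPS_orthogonal _ hP1)//.
  by move=> f k p q; rewrite !mu1E Llin.
have QN_orth N : 0 < N -> forall g : {poly R}, (size g <= m.+1)%N ->
    L (QN N m.+1 * g) + N * (QN N m.+1).[c] * g.[c] = 0.
  move=> N0 g sg; rewrite -nuE -/(nuN_ip mu c N _ _).
  rewrite (MOPS_orthogonal _ (hQN N N0))// => f k p q.
  by rewrite /nuN_ip lin_nu hornerD hornerZ; ring.
have [mQ [sQ _]] := hQ m.+1.
have [mP [sP _]] := hP m.
have [mP1 [sP1 _]] := hP1 m.
have [ys [xs [[QE P1E sys zy]]]] :=
  christoffel_interlacing Lpos ca mQ sQ Q_orth mP sP P_orth mP1 sP1 P1_orth.
rewrite -muE; set B := _ / _ => B0.
have GE : ('X - c%:P) * P1 m = \prod_(z <- c :: xs) ('X - z%:P) by rewrite big_cons P1E.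
have sxs : size xs = m by have [] := zy; rewrite /= sys => -[].
have [ssz ssy] := interlaced_sorted zy.
have pencil_pos N : 0 < N -> 0 < 1 + N * B.
  by move=> N0; rewrite addr_gt0// mulr_gt0.
have pencil N : 0 < N -> Q m.+1 + (N * B) *: (('X - c%:P) * P1 m) = (1 + N * B) *: QN N m.+1.
  move=> N0; have [mQN [sQN _]] := hQN N N0 m.+1; rewrite /B muE.
  apply: (uvarov_pencil Lpos ca mQ sQ Q_orth mP sP P_orth mP1 sP1 P1_orth N0 _ mQN sQN) => //.
    by rewrite -muE.
  exact: QN_orth.
rewrite GE QE in pencil.
(* Cancelling [1 + N * B] identifies the zeros of [QN N] with those of the pencil. *)
have QNws N : 0 < N -> let ws := zeros (QN N m.+1) in
   [/\ interlaced (c :: xs) ws, size ws = size ys,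
    forall k, (k < size ys)%N -> ws`_k < ys`_k &
    QN N m.+1 = \prod_(x <- ws) ('X - x%:P)].
  move=> N0; have NB0 : 0 < N * B by rewrite mulr_gt0.
  have [ws [iws sws ltws e]] := interlaced_pencil zy NB0.
  have QNE : QN N m.+1 = \prod_(x <- ws) ('X - x%:P).
    apply: (scalerI (a := 1 + N * B)); first by rewrite gt_eqF// pencil_pos.
    by rewrite -pencil.
  have [_ sws'] := interlaced_sorted iws.
  have -> : zeros (QN N m.+1) = ws by rewrite QNE (zerosE (zero_list_prod sws')).
  by [].
have zQ : zeros (Q m.+1) = ys by rewrite QE (zerosE (zero_list_prod ssy)).
have zP1 : zeros (P1 m) = xs by rewrite P1E (zerosE (zero_list_prod (path_sorted ssz))).
rewrite zQ zP1.
(* Listing [c] as the zero of index 0 treats both pairs of limits at once, with the derivative of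
   [G] in the denominator. *)
have limits k : (k < m.+1)%N ->
  ((fun N => (zeros (QN N m.+1))`_k) @ +oo --> (c :: xs)`_k) /\
  ((fun N => N * ((zeros (QN N m.+1))`_k - (c :: xs)`_k)) @ +oo -->
     - (Q m.+1).[(c :: xs)`_k] / (B * (('X - c%:P) * P1 m)^`().[(c :: xs)`_k])).
  move=> km; rewrite GE QE; apply: cvg_pencil_root; rewrite ?sys// => N N0.
    have [[_ h1 _] sws h2 _] := QNws N N0.
    by rewrite h1 ?sws ?h2 ?sys.
  have [_ sws _ QNE] := QNws N N0.
  rewrite pencil// rootZ; last by rewrite gt_eqF// pencil_pos.
  by rewrite {1}QNE root_prod_XsubC mem_nth// sws sys.
have dG x : (('X - c%:P) * P1 m)^`().[x] = (P1 m).[x] + (x - c) * (P1 m)^`().[x].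
  by rewrite derivM derivXsubC mul1r hornerD hornerM hornerXsubC.
split; [|split; [|split; [|split; [|split]]]].
- move=> N N0; have [[_ h1 h3] sws h2 _] := QNws N N0.
  have [_ _ h4] := zy.
  rewrite sws sys; do !split => //.
  + by apply: (h1 0%N); rewrite sws sys.
  + by move=> k km; apply: h2; rewrite sys.
  + by apply: h4; rewrite sys.
  + by apply: (h1 k.+1); rewrite sws sys.
- move=> k km N1 N2 N10 N12; have N20 := lt_trans N10 N12.
  have [iw1 sw1 _ QN1E] := QNws N1 N10.
  have t1 := pencil_pos N1 N10; have t2 := pencil_pos N2 N20.
  (* This parameter [s] satisfies [Q + N2 B G = (1 + N1 B) (QN1 + s G)], so the zeros for [N2] arise
     from a pencil based at those for [N1]. *)
  have s0 : 0 < (N2 - N1) * B / (1 + N1 * B).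
    by rewrite divr_gt0// mulr_gt0// subr_gt0.
  have [w [iw sw ltw e]] := interlaced_pencil iw1 s0.
  suff -> : zeros (QN N2 m.+1) = w by apply: ltw; rewrite sw1 sys.
  have [_ ssw] := interlaced_sorted iw.
  rewrite -(zerosE (zero_list_prod ssw)); congr zeros.
  apply: (scalerI (a := 1 + N2 * B)); first by rewrite gt_eqF.
  rewrite -pencil//.
  have -> : 1 + N2 * B = (1 + N1 * B) * (1 + (N2 - N1) * B / (1 + N1 * B)).
    by field; rewrite gt_eqF.
  rewrite -[in RHS]scalerA -e scalerDr -QN1E -pencil// scalerA.
  have -> : (1 + N1 * B) * ((N2 - N1) * B / (1 + N1 * B)) = (N2 - N1) * B.
    by field; rewrite gt_eqF.
  by rewrite -addrA -scalerDl; congr (_ + _ *: _); ring.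
- by have [] := limits 0%N (ltn0Sn _).
- by move=> k km; have [] := limits k.+1 km.
(* At [c] the derivative of [G] is [P1(c)]; at a zero [x] of [P1] it is [(x - c) P1'(x)]. *)
- have [_ h] := limits 0%N (ltn0Sn _).
  by move: h; rewrite /= dG subrr mul0r addr0.
- move=> k km; have [_ h] := limits k.+1 km.
  move: h; rewrite /= dG.
  have /eqP -> : root (P1 m) xs`_k by rewrite P1E root_prod_XsubC mem_nth// sxs.
  by rewrite add0r mulrA.
Qed.
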